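(* Let $m\in\mathbb{N}$, $1 \leq q_1, \dots, q_m \leq \infty$, $\vec q=(q_1,\dots,q_m)$ and $\boldsymbol{q} = \max\{q_1, \dots, q_m\}$, and let $\boldsymbol{q}'$ be the conjugate exponent of $\boldsymbol{q}$. Then, for $$1 \le r < m \left( \frac{1}{\max(\boldsymbol{q}',2)} + \frac{1}{\min(q_1,2)}+\cdots +\frac{1}{\min(q_m,2)}\right)^{-1}$$ we have $k_{\vec q, \infty}(r) = \infty$, while $k_{q_i, \infty}(r)=1$ for $1 \leq i \leq m$.
   Context: All measures are $\sigma$-finite and all $L^p$ spaces are real. The conjugate exponent $q'$ satisfies $\frac1q+\frac1{q'}=1$. For $m\in\mathbb{N}$, $1\le q_1,\dots,q_m,p,r\le\infty$ and $\vec q=(q_1,\dots,q_m)$, the constant $k_{\vec q,p}(r)\in[1,\infty]$ is the infimum of all $C\ge 1$ such that for all $\sigma$-finite measures $\mu_1,\dots,\mu_m,\nu$, all bounded $m$-linear operators $T\colon L^{q_1}(\mu_1)\times\cdots\times L^{q_m}(\mu_m)\to L^p(\nu)$, all $n_1,\dots,n_m\in\mathbb{N}$ and all functions $\{f^i_{k_i}\}_{k_i=1}^{n_i}\subset L^{q_i}(\mu_i)$ ($1\le i\le m$), $$\left\| \left(\sum_{k_1, \dots, k_m} |T(f_{k_1}^1, \dots, f_{k_m}^m)|^r\right)^{1/r}\right\|_{L^p(\nu)} \leq C \|T\| \prod_{i=1}^m \left\| \left(\sum_{k_i=1}^{n_i} |f_{k_i}^i|^r\right)^{1/r} \right\|_{L^{q_i}(\mu_i)}$$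 (with the supremum in place of the $r$-sums when $r=\infty$); $k_{\vec q,p}(r)=\infty$ if no such $C$ exists. For a single exponent $q$, $k_{q,p}(r)$ denotes the same constant with $m=1$ (linear operators $T\colon L^q(\mu)\to L^p(\nu)$). *)

(* Defs.v *)
From HB Require Import structures.
From mathcomp Require Import all_boot all_order all_algebra.
From mathcomp Require Import all_classical all_reals all_analysis.

Set Implicit Arguments.
Unset Strict Implicit.
Unset Printing Implicit Defensive.

Import Order.TTheory GRing.Theory Num.Theory.
Import numFieldNormedType.Exports.

Local Open Scope classical_set_scope.
Local Open Scope ring_scope.

(* The value at r = -oo is never used: r ranges over [1, +oo]. *)
Definition lrnorm (R : realType) (I : finType) (r : \bar R) (a : I -> R) : R :=
  match r with
  | s%:E => (\sum_i `|a i| `^ s) `^ s^-1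
  | +oo%E => \big[Num.max/0]_i `|a i|
  | -oo%E => 0
  end.

Section multilinear.
Context (R : realType) (m : nat) (d : 'I_m -> measure_display).
Context (S : forall i, measurableType (d i)).
Context (mu : forall i, {measure set (S i) -> \bar R}).
Context (q : 'I_m -> \bar R) (q1 : forall i, (1 <= q i)%E).
Context (d' : measure_display) (Y : measurableType d').
Context (nu : {measure set Y -> \bar R}) (p : \bar R) (p1 : (1 <= p)%E).
Implicit Type T : (forall i, LspaceType (mu i) (q1 i)) -> LspaceType nu p1.

(* [LspaceType] is a quotient without an algebraic structure in the library, so
   "w = a u + v in L^(q i)" is spelled out as an almost everywhere equality.
   [dfwith f i u] is f with its i-th component replaced by u. *)
Definition multilinear T : Prop :=
  forall (f : forall i, LspaceType (mu i) (q1 i)) (i : 'I_m) (a : R)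
    (u v w : LspaceType (mu i) (q1 i)),
    {ae (mu i), forall x, (w x : R) = a * (u x : R) + (v x : R)} ->
    {ae nu, forall y, (T (dfwith f i w) y : R) =
      a * (T (dfwith f i u) y : R) + (T (dfwith f i v) y : R)}.

Definition opnorm T : \bar R :=
  ereal_sup [set 'N[nu]_p[EFin \o T f]%E | f in
    [set f : forall i, LspaceType (mu i) (q1 i) |
      forall i, ('N[mu i]_(q i)[EFin \o f i] <= 1)%E]].

Definition bounded_multilinear T : Prop := multilinear T /\ (opnorm T < +oo)%E.

End multilinear.

Definition mz_ineq (R : realType) (m : nat)
    (q : 'I_m -> \bar R) (q1 : forall i, (1 <= q i)%E)
    (p : \bar R) (p1 : (1 <= p)%E) (r : \bar R) (C : R) : Prop :=
  forall (d : 'I_m -> measure_display) (S : forall i, measurableType (d i))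
    (mu : forall i, {sigma_finite_measure set (S i) -> \bar R})
    (d' : measure_display) (Y : measurableType d')
    (nu : {sigma_finite_measure set Y -> \bar R})
    (T : (forall i, LspaceType (mu i) (q1 i)) -> LspaceType nu p1),
  bounded_multilinear T ->
  forall (n : 'I_m -> nat) (f : forall i, 'I_(n i) -> LspaceType (mu i) (q1 i)),
  ('N[nu]_p[(fun y => (lrnorm r (fun k : {dffun forall i, 'I_(n i)} =>
       (T (fun i => f i (k i)) y : R)))%:E)]
   <= C%:E * opnorm T *
      \prod_(i < m) 'N[mu i]_(q i)[(fun x =>
        (lrnorm r (fun k : 'I_(n i) => (f i k x : R)))%:E)])%E.

(* The constant k_{q,p}(r) of the vector-valued (Marcinkiewicz-Zygmund)
   inequality; it is +oo when no real C is admissible since [ereal_inf set0]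
   is +oo. *)
Definition mz_const (R : realType) (m : nat)
    (q : 'I_m -> \bar R) (q1 : forall i, (1 <= q i)%E)
    (p : \bar R) (p1 : (1 <= p)%E) (r : \bar R) : \bar R :=
  ereal_inf (EFin @` [set C : R | 1 <= C /\ mz_ineq q1 p1 r C]).

(* Main.v *)
(* Positive part.  Since L^oo norms are suprema of linear functionals, fix for
   each rational vector b the functional a(b) of l^r norm at most 1 norming it.
   For almost every y the countably many inequalities
   |sum_k a(b)_k T f_k (y)| <= ||T|| ||sum_k a(b)_k f_k||_q hold at once, and
   |sum_k a(b)_k f_k| <= (sum_k |f_k|^r)^(1/r) pointwise; letting b increase to
   (T f_k (y))_k in absolute value gives the inequality with constant 1.

   Negative part.  On l_(q_1) x ... x l_(q_m) restricted to N = 2^n coordinates,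
   take an m-linear form with random coefficients +1/-1.  With x_i in {-1,0,1}^N,
   s_i the size of its support and P = prod_i s_i, a Chernoff and union bound
   gives |F(x)|^2 <= 24 m N P for all x at once, while trivially |F(x)| <= P.
   Interpolating, |F(x)| <= (24 m N)^be P^(1-be) with be = 1/max(Q',2),
   where Q is the largest q_i.
   A dyadic decomposition of each variable transfers this to the unit balls of
   l_(q_i), losing only a factor (2n+1)^m, so that
   ||F|| <= 24 m (2n+1)^m N^(be + sum_i (1/2 - 1/q_i)^+).
   Testing on the basis vectors forces
   N^(m/r) <= C ||F|| N^(sum_i 1/q_i), which fails for large n as soon as
   m/r > be + sum_i 1/min(q_i,2). *)
Require Import Defs.
From HB Require Import structures.
From mathcomp Require Import all_boot all_order all_algebra.
From mathcomp Require Import all_classical all_reals all_analysis.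
From mathcomp Require Import measurable_realfun ess_sup_inf.
From mathcomp Require Import ring lra.

Set Implicit Arguments.
Unset Strict Implicit.
Unset Printing Implicit Defensive.

Import Order.TTheory GRing.Theory Num.Theory.
Import numFieldNormedType.Exports.

Local Open Scope ring_scope.
Local Open Scope classical_set_scope.

(** * Elements of L^p *)

Section Lspace_elements.
Context d (T : measurableType d) (R : realType).
Variables (mu : {measure set T -> \bar R}) (p : \bar R) (p1 : (1 <= p)%E).

Lemma le_Lnorm_ae (f g : T -> R) :
  measurable_fun setT f -> measurable_fun setT g ->
  {ae mu, forall x, `|f x| <= `|g x|} ->
  ('N[mu]_p[EFin \o f] <= 'N[mu]_p[EFin \o g])%E.
Proof.
move=> mf mg fg; rewrite unlock.
case: p p1 => [s s1||//].
- have s0 : 0 < s by rewrite (lt_le_trans ltr01).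
  have mpow (h : T -> R) : measurable_fun setT h ->
      measurable_fun setT (fun x => (`|h x| `^ s)%:E : \bar R).
    move=> mh; apply/measurable_EFinP.
    apply: (@measurableT_comp _ _ _ _ _ _ (@powR R ^~ s)) => //.
    exact: measurableT_comp.
  apply: gt0_ler_poweR.
  + by rewrite invr_ge0 ltW.
  + by rewrite in_itv/= leey integral_ge0.
  + by rewrite in_itv/= leey integral_ge0.
  apply: ae_ge0_le_integral => //=; try exact: mpow.
  apply: filterS fg => x fgx _ /=.
  by rewrite lee_fin ge0_ler_powR// ltW.
- move=> _; case: ifPn => // _; apply: le_ess_sup.
  by apply: filterS fg => x fgx /=; rewrite lee_fin.
Qed.

(** Applying an element of [LspaceType] evaluates a chosen representative of its class, so agreement
    with [f] can only hold almost everywhere. *)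
Lemma Lspace_lift (f : T -> R) : measurable_fun setT f ->
  ('N[mu]_p[EFin \o f] < +oo)%E ->
  exists u : LspaceType mu p1, {ae mu, forall x, (u x : R) = f x}.
Proof.
move=> mf Nf.
have mf' : measurable_fun setT (f : T -> measurableTypeR R) by exact: mf.
pose g0 := isMeasurableFun.Build _ _ _ (measurableTypeR R) f mf'.
pose g : {mfun T >-> measurableTypeR R} := HB.pack f g0.
pose h : {mfun_ mu, T >-> measurableTypeR R} := (\pi_{mfun_ mu, T >-> measurableTypeR R} g)%qT.
have hg : {ae mu, forall x, (h x : R) = f x}.
  have : ae_eq_op mu (repr h) g by apply/eqmodP; rewrite reprK.
  by move=> /asboolP H; apply: (filterS _ H) => x /(_ I).
have Nh : finite_norm mu p h.
  rewrite /finite_norm (le_lt_trans _ Nf)//; apply: le_Lnorm_ae => //.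
    exact: (measurable_funPT (repr h)).
  by apply: filterS hg => x ->.
pose u0 := isFinLebesgue.Build _ _ _ _ _ p1 h Nh.
pose u : LspaceType mu p1 := HB.pack h u0.
by exists u.
Qed.

Lemma Lspace_measurable (u : LspaceType mu p1) : measurable_fun setT (u : T -> R).
Proof. exact: (measurable_funPT (repr (LebesgueSpace.sort u))). Qed.

Lemma Lspace_norm_lty (u : LspaceType mu p1) : ('N[mu]_p[EFin \o u] < +oo)%E.
Proof. by case: u => u [[]]. Qed.

End Lspace_elements.

(** * Linear operators into L^oo *)

Section lrnorm_duality.
Context (R : realType) (I : finType) (s : R) (s1 : 1 <= s).
Implicit Types a b w z : I -> R.

Let s0 : 0 < s. Proof. exact: lt_le_trans ltr01 s1. Qed.

Lemma lrnorm_ge0 w : 0 <= lrnorm s%:E w.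
Proof. exact: powR_ge0. Qed.

Lemma le_lrnorm w z : (forall i, `|w i| <= `|z i|) ->
  lrnorm s%:E w <= lrnorm s%:E z.
Proof.
move=> wz; rewrite /lrnorm; apply: ge0_ler_powR.
- by rewrite invr_ge0 ltW.
- by rewrite nnegrE sumr_ge0.
- by rewrite nnegrE sumr_ge0.
- by apply: ler_sum => i _; rewrite ge0_ler_powR// ltW.
Qed.

Lemma lrnormZ c w : lrnorm s%:E (fun i => c * w i) = `|c| * lrnorm s%:E w.
Proof.
rewrite /lrnorm; under eq_bigr do rewrite normrM powRM//.
rewrite -mulr_sumr powRM ?powR_ge0 ?sumr_ge0//.
by rewrite -powRrM mulfV ?gt_eqF// powRr1.
Qed.

Lemma lrnorm_powR w : lrnorm s%:E w `^ s = \sum_i `|w i| `^ s.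
Proof. by rewrite /lrnorm -powRrM mulVf ?gt_eqF// powRr1// sumr_ge0. Qed.

Lemma lrnorm_eq0 w : lrnorm s%:E w = 0 -> forall i, w i = 0.
Proof.
move=> w0 i; have := lrnorm_powR w; rewrite w0 powR0 ?gt_eqF// => /esym/eqP.
rewrite psumr_eq0// => /allP/(_ i); rewrite mem_index_enum => /(_ isT)/=.
by rewrite powR_eq0 normr_eq0 => /andP[/eqP].
Qed.

(** Young's inequality for the exponents [s] and [s / (s - 1)], multiplied by [s]: in this form it
    survives at [s = 1], where the second exponent would be infinite. *)
Lemma young_tangent (x y : R) : 0 <= x -> 0 <= y ->
  s * (x `^ (s - 1) * y) <= y `^ s + (s - 1) * x `^ s.
Proof.
move=> x0 y0; move: s1; rewrite le_eqVlt => /predU1P[s_eq1|s_gt1].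
  by rewrite -s_eq1 subrr powRr0 mul0r addr0 !mul1r powRr1.
have sB0 : 0 < s - 1 by rewrite subr_gt0.
have := @conjugate_powR _ y (x `^ (s - 1)) s (s / (s - 1)) y0 (powR_ge0 _ _) s0.
rewrite divr_gt0// => /(_ isT); rewrite -powRrM.
have -> : (s - 1) * (s / (s - 1)) = s by field; rewrite gt_eqF.
have -> : s^-1 + (s / (s - 1))^-1 = 1 by field; rewrite !gt_eqF.
move=> /(_ erefl).
have -> : y `^ s / s + x `^ s / (s / (s - 1)) =
          s^-1 * (y `^ s + (s - 1) * x `^ s) by field; rewrite !gt_eqF.
by rewrite ler_pdivlMl// (mulrC y).
Qed.

(** The equality case of Hölder's inequality supplies [a]. The second property covers every [z]
    dominating [b] coordinatewise with the same signs, so that countably many [b] can serve all real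
    vectors. *)
Lemma lrnorm_dual b : exists a,
  (forall w, `|\sum_i a i * w i| <= lrnorm s%:E w) /\
  (forall z, (forall i, 0 <= b i * z i /\ `|b i| <= `|z i|) ->
     lrnorm s%:E b <= \sum_i a i * z i).
Proof.
set n := lrnorm s%:E b.
have [n0|n0] := eqVneq n 0.
  exists (fun=> 0); split => [w|z _].
    by rewrite big1 ?normr0 ?lrnorm_ge0// => i _; rewrite mul0r.
  by rewrite n0 big1// => i _; rewrite mul0r.
have {}n0 : 0 < n by rewrite lt_neqAle eq_sym n0 lrnorm_ge0.
pose c i := `|b i| / n.
have c0 i : 0 <= c i by apply: divr_ge0; [exact: normr_ge0|exact: ltW].
have sumc : \sum_i c i `^ s = 1.
  rewrite (eq_bigr (fun i => `|b i| `^ s / n `^ s)); last first.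
    move=> i _; rewrite powRM ?invr_ge0 ?(ltW n0)//.
    by rewrite -(powR_inv1 (ltW n0)) powRAC powR_inv1 ?powR_ge0.
  by rewrite -mulr_suml -lrnorm_powR -/n divff// gt_eqF// powR_gt0.
exists (fun i => Num.sg (b i) * c i `^ (s - 1)); split => [w|z bz].
- apply: le_trans (ler_norm_sum _ _ _) _.
  set W := lrnorm s%:E w.
  have [W0|W0] := eqVneq W 0.
    rewrite W0 big1// => i _.
    by rewrite (lrnorm_eq0 W0) mulr0 normr0.
  have {}W0 : 0 < W by rewrite lt_neqAle eq_sym W0 lrnorm_ge0.
  pose v i := `|w i| / W.
  have v0 i : 0 <= v i by apply: divr_ge0; [exact: normr_ge0|exact: ltW].
  have sumv : \sum_i v i `^ s = 1.
    rewrite (eq_bigr (fun i => `|w i| `^ s / W `^ s)); last first.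
      move=> i _; rewrite powRM ?invr_ge0 ?(ltW W0)//.
      by rewrite -(powR_inv1 (ltW W0)) powRAC powR_inv1 ?powR_ge0.
    by rewrite -mulr_suml -lrnorm_powR -/W divff// gt_eqF// powR_gt0.
  (* Both [c] and [v] have norm 1, so summing [young_tangent] gives at most [1 + (s - 1) = s]. *)
  have H : \sum_i c i `^ (s - 1) * v i <= 1.
    rewrite -(ler_pM2l s0) mulr1 mulr_sumr.
    apply: le_trans (ler_sum _ (fun i _ => young_tangent (c0 i) (v0 i))) _.
    by rewrite big_split/= sumv -mulr_sumr sumc mulr1 subrKC.
  apply: (@le_trans _ _ (\sum_i W * (c i `^ (s - 1) * v i))).
    apply: ler_sum => i _; rewrite !normrM (ger0_norm (powR_ge0 _ _)).
    rewrite (_ : W * _ = c i `^ (s - 1) * `|w i|); last first.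
      by rewrite /v mulrCA (mulrC W) divfK ?gt_eqF.
    rewrite ler_wpM2r// ler_piMl ?powR_ge0//.
    by rewrite normr_sg lern1 leq_b1.
  by rewrite -mulr_sumr; apply: ler_piMr; [exact: ltW|exact: H].
- rewrite -[leLHS]mulr1 -[X in n * X]sumc mulr_sumr; apply: ler_sum => i _.
  have [bz1 bz2] := bz i.
  rewrite -(mulr_powRB1 (c0 i) s0) mulrA [leRHS]mulrAC.
  apply: ler_wpM2r; first exact: powR_ge0.
  rewrite /c (mulrC n) divfK ?gt_eqF//.
  case: (ltrgt0P (b i)) bz1 bz2 => [bi|bi|->].
  + rewrite pmulr_rge0// gtr0_sg// mul1r => zi.
    by rewrite (ger0_norm zi).
  + rewrite nmulr_rge0// ltr0_sg// mulN1r => zi.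
    by rewrite (ler0_norm zi).
  + by rewrite sgr0 mul0r.
Qed.

(** If the norm of [z] exceeded [K], so would [t] times that norm for some [t < 1]; rationals
    between [t * z i] and [z i] would then violate the hypothesis. *)
Lemma lrnorm_le_rat z K :
  (forall b : I -> rat,
     (forall i, 0 <= ratr (b i) * z i /\ `|ratr (b i) : R| <= `|z i|) ->
     lrnorm s%:E (fun i => ratr (b i)) <= K) ->
  lrnorm s%:E z <= K.
Proof.
move=> zK; rewrite leNgt; apply/negP => Kz.
have K0 : 0 <= K.
  apply: le_trans (zK (fun=> 0) _); first exact: lrnorm_ge0.
  by move=> i; rewrite rmorph0 mul0r normr0.
have z0 : 0 < lrnorm s%:E z by exact: le_lt_trans Kz.
have [t Kt t1] : exists2 t, K / lrnorm s%:E z < t & t < 1.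
  have /midf_lt[] : K / lrnorm s%:E z < 1 by rewrite ltr_pdivrMr// mul1r.
  by exists ((K / lrnorm s%:E z + 1) / 2).
have t0 : 0 <= t by apply/ltW/(le_lt_trans _ Kt)/divr_ge0/ltW.
have /choice[b bz] i : exists q : rat, [/\ 0 <= ratr q * z i,
    `|ratr q : R| <= `|z i| & t * `|z i| <= `|ratr q : R|].
  case: (ltrgt0P (z i)) => [zi|zi|->].
  - have /rat_in_itvoo[q] : t * z i < z i by rewrite gtr_pMl.
    rewrite in_itv/= => /andP[q1 q2].
    have q0 : 0 <= ratr q :> R by rewrite (le_trans _ (ltW q1))// mulr_ge0// ltW.
    exists q; rewrite ger0_norm//; split => //; last exact: ltW.
      by rewrite mulr_ge0// ltW.
    exact: ltW.
  - have /rat_in_itvoo[q] : z i < t * z i by rewrite -[ltLHS]mul1r ltr_nM2r.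
    rewrite in_itv/= => /andP[q1 q2].
    have q0 : ratr q <= 0 :> R.
      by rewrite (le_trans (ltW q2))// mulr_ge0_le0// ltW.
    exists q; rewrite ler0_norm//; split.
    + by rewrite mulr_le0// ltW.
    + by rewrite lerN2 ltW.
    + by rewrite mulrN lerN2 ltW.
  - by exists 0; rewrite rmorph0 normr0 mul0r mulr0.
have bK : lrnorm s%:E (fun i => ratr (b i) : R) <= K.
  by apply: zK => i; have [? ? _] := bz i.
have tb : t * lrnorm s%:E z <= lrnorm s%:E (fun i => ratr (b i) : R).
  rewrite -{1}(ger0_norm t0) -lrnormZ; apply: le_lrnorm => i.
  have [_ _ tz] := bz i; apply: le_trans tz; rewrite normrM.
  by apply: ler_wpM2r => //; rewrite ger0_norm.
have Ktz : K < t * lrnorm s%:E z by rewrite -(ltr_pdivrMr _ _ z0).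
by have := lt_le_trans Ktz (le_trans tb bK); rewrite ltxx.
Qed.

End lrnorm_duality.

(** * Linear operators with values known up to null sets *)

Section linear_operators.
Context (R : realType) d (X : measurableType d) (mu : {measure set X -> \bar R}).
Context (q : \bar R) (q1 : (1 <= q)%E).
Context d' (Y : measurableType d') (nu : {measure set Y -> \bar R}).
Variables (L : LspaceType mu q1 -> Y -> R) (M : R).
Hypothesis L_linear : forall (a : R) (u v w : LspaceType mu q1),
  {ae mu, forall x, (w x : R) = a * (u x : R) + (v x : R)} ->
  {ae nu, forall y, L w y = a * L u y + L v y}.
Hypothesis L_bounded : forall u : LspaceType mu q1,
  ('N[mu]_q[EFin \o u] <= 1)%E -> {ae nu, forall y, `|L u y| <= M}.

Lemma linear_ae0 (u : LspaceType mu q1) :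
  {ae mu, forall x, (u x : R) = 0} -> {ae nu, forall y, L u y = 0}.
Proof.
move=> u0.
(* When [u] vanishes almost everywhere, [u = -1 * u + u] is a linear relation with all three vectors
   equal to [u]. *)
have H : {ae nu, forall y, L u y = -1 * L u y + L u y}.
  by apply: L_linear; apply: filterS u0 => x ->; rewrite mulr0 addr0.
by apply: filterS H => y ->; rewrite mulN1r addNr.
Qed.

Lemma linear_scale_bound (u : LspaceType mu q1) (c : R) : 0 < c ->
  ('N[mu]_q[EFin \o u] <= c%:E)%E -> {ae nu, forall y, `|L u y| <= M * c}.
Proof.
move=> c0 uc.
have mu_ := Lspace_measurable u.
have cV : `|c^-1| = c^-1 by rewrite gtr0_norm ?invr_gt0.
have [uL uLE] : exists v : LfunType mu q1, (v : X -> R) = u.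
  suff H : (u : X -> R) \in Lfun mu q by exists (Lfun_Sub q1 H).
  by rewrite inE; apply/andP; split; rewrite inE//=; exact: Lspace_norm_lty.
have Nw : ('N[mu]_q[EFin \o (fun x => (c^-1 * u x)%R)] <= 1)%E.
  have := LnormZ uL c^-1%R; rewrite uLE => ->.
  rewrite cV -(@lee_pmul2l _ c%:E) ?lte_fin// mule1 muleA -EFinM mulfV ?gt_eqF//.
  by rewrite mul1e.
have [w wE] : exists w : LspaceType mu q1,
    {ae mu, forall x, (w x : R) = c^-1 * u x}.
  apply: Lspace_lift; first exact: measurable_funM.
  by rewrite (le_lt_trans Nw)// ltry.
(* Scaling is the case [v = z] of [L_linear], with [z] a zero vector. *)
have [z zE] : exists z : LspaceType mu q1, {ae mu, forall x, (z x : R) = 0}.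
  apply: Lspace_lift => //; rewrite Lnorm0 ?ltry//.
  by rewrite gt_eqF// (lt_le_trans _ q1).
have wM : {ae nu, forall y, `|L w y| <= M}.
  apply: L_bounded; apply: le_trans Nw; apply: le_Lnorm_ae => //.
  - exact: Lspace_measurable.
  - exact: measurable_funM.
  - by apply: filterS wE => x ->.
have Lw : {ae nu, forall y, L w y = c^-1 * L u y + L z y}.
  by apply: L_linear; apply: filterS2 wE zE => x -> ->; rewrite addr0.
have Lo := linear_ae0 zE.
apply: filterS3 wM Lw Lo => y wMy Lwy Lz0; move: wMy; rewrite Lwy Lz0 addr0 normrM cV.
by rewrite mulrC ler_pdivrMr.
Qed.

Lemma linear_comb (I : finType) (g : I -> LspaceType mu q1) (a : I -> R) :
  exists w : LspaceType mu q1,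
    {ae mu, forall x, (w x : R) = \sum_i a i * (g i x : R)} /\
    {ae nu, forall y, L w y = \sum_i a i * L (g i) y}.
Proof.
elim: (index_enum I) => [|i s [w [w1 w2]]].
  have [z zE] : exists z : LspaceType mu q1, {ae mu, forall x, (z x : R) = 0}.
    apply: Lspace_lift => //; rewrite Lnorm0 ?ltry//.
    by rewrite gt_eqF// (lt_le_trans _ q1).
  exists z; split; first by apply: filterS zE => x ->; rewrite big_nil.
  by have := linear_ae0 zE; apply: filterS => y ->; rewrite big_nil.
have mgi := Lspace_measurable (g i); have mw := Lspace_measurable w.
have toL (u : LspaceType mu q1) : (u : X -> R) \in Lfun mu q.
  by rewrite inE; apply/andP; split; rewrite inE//=;
    [exact: Lspace_measurable|exact: Lspace_norm_lty].
have /andP[] : (a i *: (g i : X -> R) + (w : X -> R)) \in Lfun mu q.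
  have := @Lfun_submod_closed _ _ _ mu q q1; case=> _; exact.
rewrite !inE => m1 n1.
have [v vE] := Lspace_lift q1 m1 n1.
exists v; split.
  by apply: filterS2 vE w1 => x -> wx; rewrite big_cons/= -wx.
have : {ae nu, forall y, L v y = a i * L (g i) y + L w y}.
  by apply: L_linear; apply: filterS vE => x ->.
by move=> H; apply: filterS2 H w2 => y -> wy; rewrite big_cons -wy.
Qed.

Lemma measurable_lrnorm (I : finType) (g : I -> X -> R) (s : R) :
  (forall i, measurable_fun setT (g i)) ->
  measurable_fun setT (fun x => lrnorm s%:E (fun i => g i x)).
Proof.
move=> mg; apply: (@measurableT_comp _ _ _ _ _ _ (@powR R ^~ s^-1)) => //.
apply: measurable_sum => i.
apply: (@measurableT_comp _ _ _ _ _ _ (@powR R ^~ s)) => //.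
exact: measurableT_comp.
Qed.

(** The norming functional of a rational vector yields one combination of the [g i], dominated
    pointwise by their l^s norm and hence mapped below [M * C] off a null set. At every remaining
    point [lrnorm_le_rat] recovers the full norm. *)
Lemma linear_lrnorm_bound (I : finType) (g : I -> LspaceType mu q1) (s C : R) :
  1 <= s -> 0 < C ->
  ('N[mu]_q[EFin \o (fun x => lrnorm s%:E (fun i => (g i x : R)))] <= C%:E)%E ->
  {ae nu, forall y, lrnorm s%:E (fun i => L (g i) y) <= M * C}.
Proof.
move=> s1 C0 gC.
have Hb (b : {ffun I -> rat}) : {ae nu, forall y,
    (forall i, 0 <= ratr (b i) * L (g i) y /\ `|ratr (b i) : R| <= `|L (g i) y|) ->
    lrnorm s%:E (fun i => ratr (b i)) <= M * C}.
  have [a [a1 a2]] := lrnorm_dual s1 (fun i => ratr (b i) : R).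
  have [w [w1 w2]] := linear_comb g a.
  have : {ae nu, forall y, `|L w y| <= M * C}.
    apply: linear_scale_bound => //; apply: le_trans gC.
    apply: le_Lnorm_ae => //.
    - exact: Lspace_measurable.
    - by apply: measurable_lrnorm => i; exact: Lspace_measurable.
    - by apply: filterS w1 => x ->; rewrite (ger0_norm (lrnorm_ge0 _ _)).
  move=> H; apply: filterS2 H w2 => y + Lwy by_; rewrite Lwy.
  by apply: le_trans; rewrite (le_trans (a2 _ by_))// ler_norm.
(* Enumerating the rational vectors through [unpickle] turns the exceptional null sets into a
   sequence, whose union is null. *)
pose P n y := if @unpickle {ffun I -> rat} n is Some b then
    (forall i, 0 <= ratr (b i) * L (g i) y /\ `|ratr (b i) : R| <= `|L (g i) y|) ->
    lrnorm s%:E (fun i => ratr (b i) : R) <= M * C else True.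
have : {ae nu, forall y, forall n, P n y}.
  apply: ae_foralln => n; rewrite /P; case: unpickle => [b|]; first exact: Hb.
  exact: aeW.
apply: filterS => y Py; apply: lrnorm_le_rat => // b bz.
have := Py (pickle [ffun i => b i]); rewrite /P pickleK.
have -> : (fun i => ratr ([ffun i => b i] i)) = (fun i => ratr (b i)) :> (I -> R).
  by apply/funext => i; rewrite ffunE.
by apply=> i; rewrite ffunE.
Qed.

End linear_operators.

Lemma mz_ineq_linear_Loo (R : realType) (q : 'I_1 -> \bar R)
    (q1 : forall i, (1 <= q i)%E) (s : R) :
  1 <= s -> mz_ineq q1 (leey 1) s%:E 1.
Proof.
move=> s1 d S mu d' Y nu T [Tlin Topn] n f.
have f0 i : LspaceType (mu i) (q1 i).
  have /cid[z _] : exists z : LspaceType (mu i) (q1 i),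
      {ae mu i, forall x, (z x : R) = cst 0 x}.
    apply: Lspace_lift => //; rewrite Lnorm0 ?ltry//.
    by rewrite gt_eqF// (lt_le_trans _ (q1 i)).
  exact: z.
(* [f0] is an arbitrary base point: over ['I_1], [dfwith] overwrites its only component. *)
pose L u y : R := T (dfwith f0 (@ord0 0) u) y.
have famE (g : forall i, LspaceType (mu i) (q1 i)) :
    dfwith f0 (@ord0 0) (g ord0) = g.
  by apply: functional_extensionality_dep => i; rewrite (ord1 i) dfwithin.
have famN u : (forall i, 'N[mu i]_(q i)[EFin \o dfwith f0 (@ord0 0) u i] <= 1)%E
    <-> ('N[mu ord0]_(q ord0)[EFin \o u] <= 1)%E.
  split=> [/(_ ord0)|H i]; first by rewrite dfwithin.
  by rewrite (ord1 i) dfwithin.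
have op0 : (0 <= opnorm T)%E.
  have [z zE] : exists z : LspaceType (mu ord0) (q1 ord0),
      {ae mu ord0, forall x, (z x : R) = cst 0 x}.
    apply: Lspace_lift => //; rewrite Lnorm0 ?ltry//.
    by rewrite gt_eqF// (lt_le_trans _ (q1 ord0)).
  apply: le_trans (Lnorm_ge0 nu +oo%E (EFin \o T (dfwith f0 (@ord0 0) z))) _.
  apply: ereal_sup_ubound; exists (dfwith f0 (@ord0 0) z) => //=.
  apply/famN; apply: (@le_trans _ _ ('N[mu ord0]_(q ord0)[cst 0])%E).
    apply: le_Lnorm_ae => //; first exact: Lspace_measurable.
    by apply: filterS zE => x ->.
  by rewrite Lnorm0// gt_eqF// (lt_le_trans _ (q1 ord0)).
have opT : opnorm T \is a fin_num by rewrite ge0_fin_numE.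
set M := fine (opnorm T).
have ME : M%:E = opnorm T by rewrite fineK.
have Loo_bound (g : Y -> R) (c : R) : 0 <= c ->
    {ae nu, forall y, `|g y| <= c} ->
    ('N[nu]_+oo[(fun y => (g y)%:E)] <= c%:E)%E.
  move=> c0 gc; rewrite unlock; case: ifPn => // _.
  by apply/ess_supP; apply: filterS gc => y; rewrite /= lee_fin.
have M0 : 0 <= M by rewrite fine_ge0.
have Llin (a : R) (u v w : LspaceType (mu ord0) (q1 ord0)) :
    {ae mu ord0, forall x, (w x : R) = a * (u x : R) + (v x : R)} ->
    {ae nu, forall y, L w y = a * L u y + L v y}.
  exact: Tlin.
have Lbd (u : LspaceType (mu ord0) (q1 ord0)) :
    ('N[mu ord0]_(q ord0)[EFin \o u] <= 1)%E -> {ae nu, forall y, `|L u y| <= M}.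
  move=> /famN u1.
  have : ('N[nu]_+oo[EFin \o L u] <= M%:E)%E.
    by rewrite ME; apply: ereal_sup_ubound; exists (dfwith f0 (@ord0 0) u).
  (* For a zero measure [nu] the L^oo norm is 0 by convention and bounds nothing, but then every
     property holds almost everywhere. *)
  rewrite unlock; case: ifPn => [_ /ess_supP|nu0 _].
    by apply: filterS => y; rewrite /= lee_fin.
  have nuT0 : nu setT = 0 by apply/eqP; rewrite eq_le measure_ge0 leNgt nu0.
  by exists setT; split.
rewrite big_ord1 mul1e -ME.
set G := (X in (_ <= _ * X)%E).
pose K := {dffun forall i : 'I_1, 'I_(n i)}.
pose g (k : K) := f ord0 (k ord0).
have TE (k : K) y : T (fun i => f i (k i)) y = L (g k) y :> R.
  by rewrite /L /g -[in LHS](famE (fun i => f i (k i))).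
have gG : ('N[mu ord0]_(q ord0)[EFin \o (fun x =>
    lrnorm s%:E (fun k => (g k x : R)))] <= G)%E.
  have mg (I : finType) (h : I -> LspaceType (mu ord0) (q1 ord0)) :
      measurable_fun setT (fun x => lrnorm s%:E (fun k => (h k x : R))).
    by apply: measurable_lrnorm => k; exact: Lspace_measurable.
  apply: le_Lnorm_ae => //; try exact: mg.
  apply: aeW => x.
  rewrite (ger0_norm (lrnorm_ge0 _ _)) (ger0_norm (lrnorm_ge0 _ _)).
  apply: ge0_ler_powR; rewrite ?nnegrE ?sumr_ge0//.
    by rewrite invr_ge0 (le_trans ler01).
  (* A function [k] on ['I_1] is determined by [k ord0], so each fibre of this evaluation
     contributes at most one term. *)
  rewrite (partition_big (fun k : K => k ord0) predT)//=.
  apply: ler_sum => j _.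
  rewrite (eq_bigr (fun=> `|f ord0 j x : R| `^ s)); last first.
    by move=> k /eqP kj; rewrite /g kj.
  rewrite sumr_const -[leRHS]mulr1n ler_wpMn2l ?powR_ge0//.
  apply/card_le1_eqP => k l /eqP kj /eqP lj.
  by apply/ffunP => i; rewrite (ord1 i); apply/val_inj; rewrite kj lj.
(* An infinite [G] makes the bound trivial unless [M = 0]; then the right-hand side is 0 and each
   [L (g k)] has to vanish almost everywhere. *)
have [Gy|Gfin] := eqVneq G +oo%E.
  have [M_eq0|M_neq0] := eqVneq M 0; last first.
    by rewrite Gy gt0_muley ?leey// lte_fin lt_neqAle eq_sym M_neq0.
  rewrite M_eq0 mul0e; apply: Loo_bound => //.
  have : {ae nu, forall y, forall k : K, `|L (g k) y| <= 0}.
    apply: filter_forall => k.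
    have := Lspace_norm_lty (g k); set c := 'N[_]_(_)[_]%E => cy.
    have cE : (fine c)%:E = c by rewrite fineK// ge0_fin_numE// Lnorm_ge0.
    have := linear_scale_bound Llin Lbd (u := g k) (c := fine c + 1).
    rewrite M_eq0 mul0r; apply.
      by rewrite ltr_wpDl// fine_ge0// Lnorm_ge0.
    by rewrite EFinD cE leeDl.
  apply: filterS => y Ly.
  rewrite (ger0_norm (lrnorm_ge0 _ _)).
  have -> : (fun k : K => T (fun i => f i (k i)) y : R) = (fun k => 0 * 0).
    apply/funext => k; rewrite TE mul0r; apply/eqP.
    by rewrite -normr_le0.
  by rewrite lrnormZ// normr0 mul0r.
have G0 : (0 <= G)%E by exact: Lnorm_ge0.
have GE : (fine G)%:E = G by rewrite fineK// ge0_fin_numE// ltey.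
apply/lee_addgt0Pr => e e0.
(* The slack keeps [C] positive even if [G = 0], and costs only [M * e / (M + 1) <= e]. *)
pose C := fine G + e / (M + 1).
have eM : 0 < e / (M + 1) by rewrite divr_gt0// ltr_wpDl.
have C0 : 0 < C by rewrite ltr_wpDl// fine_ge0.
apply: (@le_trans _ _ (M * C)%:E).
  apply: Loo_bound; first by rewrite mulr_ge0// ltW.
  have gC : ('N[mu ord0]_(q ord0)[EFin \o (fun x =>
      lrnorm s%:E (fun k => (g k x : R)))] <= C%:E)%E.
    by apply: le_trans gG _; rewrite -GE lee_fin lerDl ltW.
  have := linear_lrnorm_bound Llin Lbd s1 C0 gC.
  apply: filterS => y; rewrite (ger0_norm (lrnorm_ge0 _ _)).
  have -> : (fun k : K => T (fun i => f i (k i)) y : R) = (fun k => L (g k) y).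
    by apply/funext => k; exact: TE.
  by [].
rewrite -GE -EFinM -EFinD lee_fin mulrDr lerD2l mulrCA ler_piMr ?(ltW e0)//.
by rewrite ler_pdivrMr ?ltr_wpDl// mul1r lerDl.
Qed.

(** * Multilinear forms with random signs *)

Section signs.
Context (R : realType).

(** The exponent [2 * x ^+ 2] leaves room for a proof from [1 + t <= expR t]: if [2 * x ^+ 2 <= 1],
    this yields [(expR x + expR (- x)) * (1 - x ^+ 2) <= 2]; otherwise [|x| <= 2 * x ^+ 2]. *)
Lemma cosh_le_expR_sqr (x : R) : expR x + expR (- x) <= 2 * expR (2 * x ^+ 2).
Proof.
wlog x0 : x / 0 <= x.
  move=> H; have [/H//|/ltW x0] := leP 0 x.
  by have := H (- x); rewrite oppr_ge0 opprK sqrrN addrC; exact.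
have [x1|x1] := leP (2 * x ^+ 2) 1.
- have x_lt1 : x < 1 by nra.
  have e1 : expR (- x) * (1 + x) <= 1.
    have := ler_wpM2l (expR_ge0 (- x)) (expR_ge1Dx x).
    by rewrite (mulrC _ (expR x)) expRxMexpNx_1.
  have e2 : expR x * (1 - x) <= 1.
    have := ler_wpM2l (expR_ge0 x) (expR_ge1Dx (- x)).
    by rewrite expRxMexpNx_1.
  have e3 := expR_ge1Dx (2 * x ^+ 2).
  suff : expR x + expR (- x) <= 2 * (1 + 2 * x ^+ 2) by lra.
  have H : (expR x + expR (- x)) * (1 - x ^+ 2) <= 2.
    have -> : (expR x + expR (- x)) * (1 - x ^+ 2) =
      expR x * (1 - x) * (1 + x) + expR (- x) * (1 + x) * (1 - x) by ring.
    have := ler_wpM2r (_ : 0 <= 1 + x) e2; have := ler_wpM2r (_ : 0 <= 1 - x) e1.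
    lra.
  have d0 : 0 < 1 - x ^+ 2 by lra.
  rewrite -(ler_pM2r d0); apply: le_trans H _.
  have : 0 <= x ^+ 2 * (1 - 2 * x ^+ 2).
    by apply: mulr_ge0; [exact: sqr_ge0|lra].
  have -> : 2 * (1 + 2 * x ^+ 2) * (1 - x ^+ 2) =
    2 + 2 * (x ^+ 2 * (1 - 2 * x ^+ 2)) by ring.
  lra.
- have xx : x <= 2 * x ^+ 2.
    have [|x2] := leP 1 (2 * x); last by nra.
    move=> x2; have := ler_wpM2r x0 x2; rewrite mul1r expr2; lra.
  have e1 : expR x <= expR (2 * x ^+ 2) by rewrite ler_expR.
  have e2 : expR (- x) <= expR (2 * x ^+ 2).
    by rewrite ler_expR; apply: le_trans xx; lra.
  lra.
Qed.

Definition sgb (b : bool) : R := (-1) ^+ b.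

(** The sum over sign patterns is an unnormalised expectation over independent signs, so the
    exponential moment factorises. *)
Lemma sum_sign_expR (I : finType) (c : I -> R) :
  \sum_(a : {ffun I -> bool}) expR (\sum_i sgb (a i) * c i) =
  \prod_i (expR (c i) + expR (- c i)).
Proof.
rewrite (eq_bigr (fun a : {ffun I -> bool} => \prod_i expR (sgb (a i) * c i))).
  rewrite -(bigA_distr_bigA (fun i b => expR (sgb b * c i))).
  apply: eq_bigr => i _; rewrite big_bool/= /sgb expr1 expr0.
  by rewrite mulN1r mul1r addrC.
by move=> a _; rewrite expR_sum.
Qed.

Lemma sum_sign_expR_le (I : finType) (c : I -> R) :
  \sum_(a : {ffun I -> bool}) expR (\sum_i sgb (a i) * c i) <=
  2 ^+ #|I| * expR (2 * \sum_i c i ^+ 2).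
Proof.
rewrite sum_sign_expR mulr_sumr expR_sum -prodr_const -big_split/=.
apply: ler_prod => i _; rewrite cosh_le_expR_sqr andbT.
by rewrite addr_ge0// expR_ge0.
Qed.

(* Union bound over the finite family of tests [c x] with a Chernoff estimate
   for each of them. *)
Lemma exists_sign_small (I X : finType) (c : X -> I -> R) (K : R) :
  2 * #|X|%:R < expR K ->
  exists a : I -> bool, forall x,
    (\sum_i sgb (a i) * c x i) ^+ 2 <= 8 * K * \sum_i c x i ^+ 2.
Proof.
move=> XK; apply: contrapT => H.
pose S (a : {ffun I -> bool}) x : R := \sum_i sgb (a i) * c x i.
pose V x : R := \sum_i c x i ^+ 2.
have V0 x : 0 <= V x by apply: sumr_ge0 => i _; exact: sqr_ge0.
have bad (a : {ffun I -> bool}) : exists x, 8 * K * V x < S a x ^+ 2.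
  apply: contrapT => Ha; apply: H; exists a => x; rewrite leNgt.
  by apply/negP => Hx; apply: Ha; exists x.
(* Chernoff parameter: [2 * l ^+ 2 * V <= K] bounds the normalised exponential moment by [expR K],
   while [S ^+ 2 > 8 * K * V] forces [l * |S| >= 2 * K]. *)
pose l x : R := Num.sqrt (K / (2 * V x)).
(* A violated test exists, so [2 <= 2 * #|X| < expR K], which excludes [K <= 0]. *)
have [K0|K0] := leP K 0.
  have [x _] := bad [ffun=> true].
  have : 1 <= #|X|%:R :> R by rewrite ler1n; apply/card_gt0P; exists x.
  move: XK; have : expR K <= 1 by rewrite expR_le1.
  by move=> ? ? ?; lra.
have KV x : 0 <= K / (2 * V x).
  by apply: divr_ge0; [exact: ltW|exact: mulr_ge0].
have lV x : 2 * (l x ^+ 2 * V x) <= K.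
  rewrite sqr_sqrtr//.
  have [->|Vx] := eqVneq (V x) 0; first by rewrite mulr0 mulr0 ltW.
  rewrite (_ : 2 * _ = K)//; by field.
have bad_exp (a : {ffun I -> bool}) : exists x,
    expR (2 * K) <= expR (l x * S a x) + expR (- (l x * S a x)).
  have [x Sx] := bad a; exists x.
  have Vx : 0 < V x.
    rewrite lt_neqAle V0 andbT eq_sym; apply/eqP => Vx.
    move: Sx; rewrite Vx mulr0; suff -> : S a x = 0 by rewrite expr0n ltxx.
    rewrite /S big1// => i _; have /eqP := Vx.
    rewrite psumr_eq0 => [/allP/(_ i)|j _]; last exact: sqr_ge0.
    by rewrite mem_index_enum sqrf_eq0 => /(_ isT)/eqP ->; rewrite mulr0.
  have lS : 2 * K <= l x * `|S a x|.
    rewrite -(@ler_pXn2r _ 2) ?nnegrE ?(mulr_ge0 (sqrtr_ge0 _)) ?(mulr_ge0 _ (ltW K0))//.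
    rewrite [in leRHS]exprMn real_normK ?num_real// sqr_sqrtr//.
    rewrite mulrAC ler_pdivlMr ?mulr_gt0//.
    rewrite (_ : _ * (2 * V x) = K * (8 * K * V x)); last by ring.
    by rewrite ler_pM2l// ltW.
  case: (lerP 0 (S a x)) => Sx0.
  + rewrite ger0_norm// in lS.
    by rewrite ler_wpDr ?expR_ge0// ler_expR.
  + rewrite ltr0_norm// mulrN in lS.
    by rewrite ler_wpDl ?expR_ge0// ler_expR.
(* Every sign pattern violates some test, so the double sum of exponentials over patterns and tests
   dominates the left side; summing over patterns first gives the right side. *)
have : 2 ^+ #|I| * expR (2 * K) <= 2 ^+ #|I| * (2 * #|X|%:R * expR K).
  have -> : 2 ^+ #|I| * expR (2 * K) = \sum_(a : {ffun I -> bool}) expR (2 * K).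
    by rewrite sumr_const card_ffun card_bool -[RHS]mulr_natl natrX.
  apply: (@le_trans _ _ (\sum_(a : {ffun I -> bool}) \sum_x
      (expR (l x * S a x) + expR (- (l x * S a x))))).
    apply: ler_sum => a _; have [x Hx] := bad_exp a.
    rewrite (bigD1 x)//=; apply: ler_wpDr; last exact: Hx.
    by apply: sumr_ge0 => y _; apply: addr_ge0; exact: expR_ge0.
  rewrite exchange_big/=.
  have -> : 2 ^+ #|I| * (2 * #|X|%:R * expR K) =
      \sum_(x : X) (2 * (2 ^+ #|I| * expR K)).
    by rewrite sumr_const -[RHS]mulr_natl; ring.
  apply: ler_sum => x _; rewrite big_split/=.
  have Hs (t : R) : t ^+ 2 = l x ^+ 2 ->
      \sum_(a : {ffun I -> bool}) expR (t * S a x) <= 2 ^+ #|I| * expR K.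
    move=> tl; apply: (@le_trans _ _ (2 ^+ #|I| * expR (2 * \sum_i (t * c x i) ^+ 2))).
      apply: le_trans (sum_sign_expR_le _); apply: ler_sum => a _.
      rewrite ler_expR mulr_sumr le_eqVlt; apply/orP; left; apply/eqP.
      by apply: eq_bigr => i _; rewrite mulrCA.
    rewrite ler_pM2l ?exprn_gt0// ler_expR.
    rewrite (eq_bigr (fun i => l x ^+ 2 * c x i ^+ 2)); last first.
      by move=> i _; rewrite exprMn tl.
    by rewrite -mulr_sumr.
  rewrite mulrDl mul1r; apply: lerD; first exact: Hs.
  under eq_bigr do rewrite -mulNr.
  by apply: Hs; rewrite sqrrN.
rewrite ler_pM2l ?exprn_gt0// (_ : 2 * K = K + K); last by ring.
by rewrite expRD ler_pM2r ?expR_gt0// leNgt XK.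
Qed.

End signs.

(** * From vectors with entries -1, 0, 1 to weak l_q balls *)

Section flat_vectors.
Context (R : realType).

Definition osgb (o : option bool) : R := if o is Some b then sgb R b else 0.

Lemma norm_sgb b : `|sgb R b| = 1.
Proof. by rewrite /sgb normrX normrN1 expr1n. Qed.

(* The unit ball of weak l_q, for al = 1/q; with q = oo (al = 0) it is the unit
   ball of l_oo, [A] being nonempty. *)
Definition wball (J : finType) (al : R) (x : J -> R) := forall (A : {set J}) t,
  (0 < #|A|)%N -> 0 <= t -> (forall j, j \in A -> t <= `|x j|) ->
  t * #|A|%:R `^ al <= 1.

(** Take for [o] the signs of [g] on [A] and 0 elsewhere. *)
Lemma flat_set_bound (J : finType) (g : J -> R) (M al : R) (A : {set J}) :
  (forall o : {ffun J -> option bool},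
    `|\sum_j osgb (o j) * g j| <= M * (\sum_j `|osgb (o j)|) `^ al) ->
  \sum_(j in A) `|g j| <= M * #|A|%:R `^ al.
Proof.
move=> /(_ [ffun j => if j \in A then Some (g j < 0) else None]).
rewrite (eq_bigr (fun j => if j \in A then `|g j| else 0)); last first.
  move=> j _; rewrite ffunE; case: ifPn => _; last by rewrite mul0r.
  rewrite /= /sgb; case: ltrP => gj.
    by rewrite expr1 mulN1r ltr0_norm.
  by rewrite expr0 mul1r ger0_norm.
rewrite -big_mkcond/= [in X in _ -> X](_ : #|A|%:R = \sum_(j in A) (1 : R)).
  rewrite [X in _ <= _ * X `^ _](_ : _ = \sum_(j in A) 1).
    by apply: le_trans; exact: ler_norm.
  rewrite [RHS]big_mkcond/=; apply: eq_bigr => j _; rewrite ffunE.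
  by case: ifPn => _; rewrite ?normr0// norm_sgb.
by rewrite sumr_const.
Qed.

(* The levels [2^-(i+1) < |x j| <= 2^-i] for [i < n] contribute [2 M] each. *)
Lemma dyadic_bound (J : finType) (g x : J -> R) (M al : R) (n : nat) :
  0 <= M -> al <= 1 -> (#|J| <= 2 ^ n)%N ->
  (forall o : {ffun J -> option bool},
    `|\sum_j osgb (o j) * g j| <= M * (\sum_j `|osgb (o j)|) `^ al) ->
  wball al x ->
  `|\sum_j x j * g j| <= (2 * n%:R + 1) * M.
Proof.
move=> M0 al1 Jn flat xw.
have x1 j : `|x j| <= 1.
  have := xw [set j]%SET `|x j|; rewrite cards1 powR1 mulr1; apply => //.
  by move=> i /set1P ->.
apply: le_trans (ler_norm_sum _ _ _) _.
under eq_bigr do rewrite normrM.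
pose h k : R := (2^-1) ^+ k.
have h0 k : 0 < h k by rewrite exprn_gt0.
have hS k : h k = 2 * h k.+1 by rewrite /h exprS mulrA divff// mul1r.
pose A k := [set j | `|x j| <= h k]%SET.
have step k : \sum_j `|x j| * `|g j| <=
    2 * k%:R * M + \sum_(j in A k) `|x j| * `|g j|.
  elim: k => [|k IH].
    rewrite mulr0 mul0r add0r le_eqVlt; apply/orP; left; apply/eqP.
    by apply: eq_bigl => j; rewrite inE /h expr0 x1.
  apply: le_trans IH _; rewrite -[k.+1%:R]natr1 mulrDr mulr1 mulrDl -addrA lerD2l.
  rewrite (big_setID (A k.+1))/= addrC.
  have -> : A k :&: A k.+1 = A k.+1.
    apply/finset.setIidPr/fintype.subsetP => j; rewrite !inE => /le_trans; apply.
    by rewrite (hS k) ler_peMl ?ltW// ltr1n.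
  rewrite lerD2r; have [D0|D0] := posnP #|A k :\: A k.+1|.
    by rewrite (cards0_eq D0) big_set0 mulr_ge0.
  apply: (@le_trans _ _ (h k * (M * #|A k :\: A k.+1|%:R `^ al))).
    apply: le_trans (ler_wpM2l (ltW (h0 k)) (flat_set_bound _ flat)).
    rewrite mulr_sumr; apply: ler_sum => j; rewrite !inE => /andP[_ xj].
    exact: ler_wpM2r.
  (* On this level [|x j| > h k.+1 = h k / 2], so the weak l_q condition bounds [h k] times the size
     to the power [al] by 2. *)
  rewrite mulrCA mulrC ler_wpM2r// (hS k) -mulrA ler_piMr//.
  apply: xw => //; first exact: ltW.
  by move=> j; rewrite !inE -ltNge => /andP[/ltW].
apply: le_trans (step n) _; rewrite [leRHS]mulrDl mul1r lerD2l.
(* The remaining entries are at most [2^-n] and number at most [2^n]; with [al <= 1] they contribute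
   at most [M], the final [+ 1]. *)
have [D0|D0] := posnP #|A n|; first by rewrite (cards0_eq D0) big_set0.
apply: (@le_trans _ _ (h n * (M * #|A n|%:R `^ al))).
  apply: le_trans (ler_wpM2l (ltW (h0 n)) (flat_set_bound _ flat)).
  rewrite mulr_sumr; apply: ler_sum => j; rewrite !inE => xj.
  exact: ler_wpM2r.
rewrite mulrCA ler_piMr//.
have hn : h n * 2 ^+ n = 1 by rewrite /h -exprMn mulVf// expr1n.
rewrite -[leRHS]hn ler_pM2l//; apply: (@le_trans _ _ #|A n|%:R).
  by apply: ler1_powR => //; rewrite ler1n.
by rewrite -natrX ler_nat (leq_trans (max_card _)).
Qed.

End flat_vectors.

(** * Multilinear forms, treated one variable at a time *)

Section multilinear_forms.
Context (R : realType) (m : nat) (J : finType).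
Variable a : {ffun 'I_m -> J} -> R.

Definition mform (x : 'I_m -> J -> R) : R :=
  \sum_(k : {ffun 'I_m -> J}) a k * \prod_i x i (k i).

Definition mform_coef (x : 'I_m -> J -> R) (i0 : 'I_m) (j : J) : R :=
  \sum_(k : {ffun 'I_m -> J} | k i0 == j) a k * \prod_(i | i != i0) x i (k i).

Lemma mform_expand x i0 : mform x = \sum_j x i0 j * mform_coef x i0 j.
Proof.
rewrite /mform (partition_big (fun k : {ffun 'I_m -> J} => k i0) predT)//=.
apply: eq_bigr => j _; rewrite mulr_sumr; apply: eq_bigr => k /eqP kj.
by rewrite (bigD1 i0)//= kj mulrCA.
Qed.

Lemma eq_mform_coef x y i0 j : (forall i, i != i0 -> x i = y i) ->
  mform_coef x i0 j = mform_coef y i0 j.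
Proof.
move=> xy; apply: eq_bigr => k _; congr (_ * _).
by apply: eq_bigr => i ii0; rewrite xy.
Qed.

(** [dyadic_bound] is applied to each variable in turn, the others being frozen in the coefficients
    of a linear form; each application costs a factor [2 * n + 1]. *)
Lemma mform_bound (al : 'I_m -> R) (M : R) (n : nat) :
  0 <= M -> (forall i, al i <= 1) -> (#|J| <= 2 ^ n)%N ->
  (forall o : 'I_m -> {ffun J -> option bool},
    `|mform (fun i j => osgb R (o i j))| <=
      M * \prod_i (\sum_j `|osgb R (o i j)|) `^ al i) ->
  forall x, (forall i, wball (al i) (x i)) ->
  `|mform x| <= M * (2 * n%:R + 1) ^+ m.
Proof.
move=> M0 al1 Jn flat.
pose D : R := 2 * n%:R + 1.
have D0 : 0 <= D by rewrite addr_ge0// mulr_ge0.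
(* Induction invariant: variables not yet flat have index below [l] and weight [D]; a flat variable
   has as weight its support size to the power [al i]. *)
have H (l : nat) (x : 'I_m -> J -> R) (w : 'I_m -> R) :
    (forall i : 'I_m, [/\ (i < l)%N, wball (al i) (x i) & w i = D] \/
       exists2 o : {ffun J -> option bool}, x i = (fun j => osgb R (o j)) &
         w i = (\sum_j `|osgb R (o j)|) `^ al i) ->
    `|mform x| <= M * \prod_i w i.
  elim: l x w => [|l IH] x w xw.
    have /choice[s xs] i : exists o : {ffun J -> option bool},
        x i = (fun j => osgb R (o j)) /\ w i = (\sum_j `|osgb R (o j)|) `^ al i.
      by have [[//]|[s ? ?]] := xw i; exists s.
    rewrite (_ : x = fun i j => osgb R (s i j)); last first.
      by apply/funext => i; have [] := xs i.
    by rewrite (eq_bigr _ (fun i _ => (xs i).2)); exact: flat.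
  have w0 i : 0 <= w i.
    by have [[_ _ ->//]|[s _ ->]] := xw i; rewrite powR_ge0.
  have [lm|ml] := ltnP l m; last first.
    apply: IH => i; have [[_ ? ?]|?] := xw i; [left|by right].
    by split => //; exact: leq_trans ml.
  pose i0 := Ordinal lm.
  have lt_l (i : 'I_m) : i != i0 -> (i < l.+1)%N -> (i < l)%N.
    by rewrite ltnS leq_eqVlt -(inj_eq val_inj)/= => /negbTE ->.
  have [[_ xi0 wi0]|xi0] := xw i0; last first.
    apply: IH => i; have [->|ii0] := eqVneq i i0; first by right.
    by have [[? ? ?]|?] := xw i; [left; split=> //; exact: lt_l|right].
  rewrite (mform_expand x i0) (bigD1 i0)//= wi0 mulrCA mulrC.
  rewrite mulrC; apply: (dyadic_bound (al := al i0)) => //.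
    by rewrite mulr_ge0// prodr_ge0.
  move=> o; pose y i := if i == i0 then fun j => osgb R (o j) else x i.
  pose v i := if i == i0 then (\sum_j `|osgb R (o j)|) `^ al i0 else w i.
  have -> : \sum_j osgb R (o j) * mform_coef x i0 j = mform y.
    rewrite (mform_expand y i0); apply: eq_bigr => j _; congr (_ * _).
      by rewrite /y eqxx.
    by apply: eq_mform_coef => i ii0; rewrite /y (negbTE ii0).
  have -> : M * (\prod_(i < m | i != i0) w i) * (\sum_j `|osgb R (o j)|) `^ al i0
      = M * \prod_i v i.
    have -> : \prod_i v i =
        (\sum_j `|osgb R (o j)|) `^ al i0 * \prod_(i | i != i0) w i.
      rewrite (bigD1 i0)//=; congr (_ * _); first by rewrite /v eqxx.
      by apply: eq_bigr => i ii0; rewrite /v (negbTE ii0).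
    by rewrite -mulrA [in LHS](mulrC (\prod_(i | _) _)).
  apply: IH => i; rewrite /y /v; case: eqVneq => [->|ii0].
    by right; exists o.
  by have [[? ? ?]|?] := xw i; [left; split=> //; exact: lt_l|right].
move=> x xw; have := H m x (fun=> D).
rewrite prodr_const card_ord; apply => i; left.
by split.
Qed.

End multilinear_forms.

(** * Sign forms that are small on flat vectors *)

Section small_forms.
Context (R : realType).

(** There are [3 ^ (m * N)] tuples of [m] flat vectors of length [N], so the union bound may use
    [K = 3 * m * N]. *)
Lemma three_pow_lt_expR (n : nat) : (0 < n)%N ->
  2 * (3 ^ n)%:R < expR (3 * n%:R) :> R.
Proof.
move=> n0; have -> : 3 * n%:R = n%:R + n%:R * 2 :> R by ring.
rewrite expRD expRM_natl natrX.
have e3 : 3 <= expR 2 :> R by apply: le_trans (expR_ge1Dx 2); lra.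
have e2 : 2 < expR n%:R :> R.
  have : (n%:R : R) != 0 by rewrite pnatr_eq0 -lt0n.
  move=> /expR_gt1Dx; apply: le_lt_trans.
  have : 1 <= n%:R :> R by rewrite ler1n.
  lra.
apply: (@lt_le_trans _ _ (expR n%:R * 3 ^+ n)); first by rewrite ltr_pM2r ?exprn_gt0.
by rewrite ler_pM2l ?expR_gt0// lerXn2r ?nnegrE ?expR_ge0.
Qed.

Lemma sum_norm_osgb (J : finType) (o : J -> option bool) :
  \sum_j `|osgb R (o j)| = #|[pred j | o j != None]|%:R.
Proof.
rewrite -sum1_card natr_sum [RHS]big_mkcond/=; apply: eq_bigr => j _.
by rewrite inE; case: (o j) => [b|]; rewrite /= ?norm_sgb ?normr0.
Qed.

Lemma sqr_osgb o : osgb R o ^+ 2 = `|osgb R o|.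
Proof.
by case: o => [b|] /=; rewrite ?norm_sgb ?normr0 ?expr0n// /sgb sqrr_sign.
Qed.

(** Write [S] as [S]^ (1 - 2 * be) * (S ^+ 2) [^ be] and bound the factors by the corresponding
    powers of [P] and [T * P]. *)
Lemma powR_interpolate (S P T be : R) : 0 <= S -> S <= P -> S ^+ 2 <= T * P ->
  0 <= T -> 0 <= be <= 2^-1 -> S <= T `^ be * P `^ (1 - be).
Proof.
move=> S0 SP STP T0 /andP[be0 be1]; have P0 := le_trans S0 SP.
have [->|Sn0] := eqVneq S 0; first by rewrite mulr_ge0 ?powR_ge0.
have Pn0 : P != 0.
  by rewrite gt_eqF// (lt_le_trans _ SP)// lt_neqAle eq_sym Sn0.
have -> : S = S `^ (1 - 2 * be) * (S ^+ 2) `^ be.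
  rewrite -powR_mulrn// -powRrM -powRD; last by rewrite Sn0 implybT.
  by rewrite subrK powRr1.
have -> : 1 - be = (1 - 2 * be) + be by ring.
rewrite [in leRHS]powRD; last by rewrite Pn0 implybT.
rewrite mulrCA -powRM//; apply: ler_pM; rewrite ?powR_ge0//.
  by apply: ge0_ler_powR; rewrite ?nnegrE//; lra.
by apply: ge0_ler_powR; rewrite ?nnegrE ?sqr_ge0 ?mulr_ge0.
Qed.

(** The last hypothesis trades each support size to the power [1 - be] for its power [al i], at the
    cost of [N] to the power [max(1/2 - al i, 0)]; nonzero flat vectors have support size between 1
    and [N]. *)
Lemma exists_mform (m n : nat) (al : 'I_m -> R) (be : R) :
  (0 < m)%N -> (forall i, 0 <= al i <= 1) -> 0 <= be <= 2^-1 ->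
  (forall i, 1 - be - al i <= Num.max (2^-1 - al i) 0) ->
  exists a : {ffun 'I_m -> 'I_(2 ^ n)} -> R, (forall k, `|a k| = 1) /\
  forall x, (forall i, wball (al i) (x i)) ->
    `|mform a x| <= 24 * m%:R *
      (2 ^+ n) `^ (be + \sum_i Num.max (2^-1 - al i) 0) * (2 * n%:R + 1) ^+ m.
Proof.
move=> m0 al01 be01 albe.
pose N := (2 ^ n)%N; pose J := 'I_N.
have N0 : (0 < N)%N by rewrite expn_gt0.
pose X := {ffun 'I_m -> {ffun J -> option bool}}.
pose c (x : X) (k : {ffun 'I_m -> J}) : R := \prod_i osgb R (x i (k i)).
have cardX : 2 * #|{: X}|%:R < expR (3 * (m * N)%:R) :> R.
  rewrite !card_ffun card_option card_bool !card_ord -expnM mulnC.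
  by apply: three_pow_lt_expR; rewrite muln_gt0 m0.
have [b bc] := exists_sign_small c cardX.
exists (fun k => sgb R (b k)); split => [k|]; first exact: norm_sgb.
have NE : (2 ^+ n : R) = N%:R by rewrite natrX.
apply: mform_bound.
- by rewrite !mulr_ge0 ?powR_ge0.
- by move=> i; have /andP[] := al01 i.
- by rewrite card_ord.
move=> o.
pose s i : R := \sum_j `|osgb R (o i j)|.
have s0 i : 0 <= s i by exact: sumr_ge0.
pose P := \prod_i s i.
have P0 : 0 <= P by apply: prodr_ge0.
set S := mform _ _.
have SP : `|S| <= P.
  apply: le_trans (ler_norm_sum _ _ _) _.
  rewrite /P /s bigA_distr_bigA/=; apply: ler_sum => k _.
  by rewrite normrM norm_sgb mul1r normr_prod.
(* The constant is [8 * K] with [K = 3 * m * N]. *)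
have S2 : `|S| ^+ 2 <= (24 * m%:R * N%:R) * P.
  rewrite real_normK ?num_real//.
  have := bc [ffun i => o i].
  rewrite (_ : \sum_i c _ i ^+ 2 = P); last first.
    rewrite /P /s bigA_distr_bigA/=; apply: eq_bigr => k _.
    rewrite /c -prodrXl; apply: eq_bigr => i _.
    by rewrite ffunE sqr_osgb.
  rewrite (_ : \sum_i _ = S); last first.
    apply: eq_bigr => k _; congr (_ * _); apply: eq_bigr => i _.
    by rewrite ffunE.
  by rewrite natrM (_ : 8 * _ = 24 * m%:R * N%:R)//; ring.
have m1 : 1 <= m%:R :> R by rewrite ler1n.
have := powR_interpolate (normr_ge0 _) SP S2 _ be01.
rewrite !mulr_ge0// => /(_ isT) H; apply: le_trans H _.
rewrite powRM ?mulr_ge0// NE -mulrA -[leRHS]mulrA.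
have /andP[be0 be1] := be01.
(* The factor [24 * m] is at least 1 and [be <= 1], so its power [be] is bounded by itself. *)
apply: ler_pM; rewrite ?powR_ge0 ?mulr_ge0 ?powR_ge0//.
  apply: ler1_powR; first by lra.
  by lra.
rewrite powRD ?pnatr_eq0 -?lt0n ?N0 ?implybT// -mulrA.
apply: ler_wpM2l; first exact: powR_ge0.
have -> : N%:R `^ (\sum_i Num.max (2^-1 - al i) 0) =
    \prod_i N%:R `^ (Num.max (2^-1 - al i) 0) :> R.
  by apply: (big_morph (fun t => N%:R `^ t)) => [u v|]; rewrite ?powRr0// powRD// pnatr_eq0 -lt0n N0 implybT.
have -> : P `^ (1 - be) = \prod_i s i `^ (1 - be).
  suff [] : 0 <= P /\ P `^ (1 - be) = \prod_i s i `^ (1 - be) by [].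
  rewrite /P; elim/big_rec2: _ => [|i y z _ [z0 <-]]; first by rewrite powR1.
  by rewrite powRM// mulr_ge0.
rewrite -big_split/=; apply: ler_prod => i _; rewrite powR_ge0/=.
(* A zero vector escapes [1 <= s i]; its term vanishes because [1 - be] is nonzero. *)
have [si0|si0] := eqVneq (s i) 0.
  rewrite si0 powR0; last by lra.
  by rewrite mulr_ge0 ?powR_ge0.
have s1 : 1 <= s i.
  by move: si0; rewrite /s sum_norm_osgb pnatr_eq0 -lt0n -(ler_nat R).
have sN : s i <= N%:R.
  by rewrite /s sum_norm_osgb ler_nat (leq_trans (max_card _))// card_ord.
have -> : 1 - be = (1 - be - al i) + al i by rewrite subrK.
rewrite powRD ?si0 ?implybT//; apply: ler_wpM2r; first exact: powR_ge0.
apply: (@le_trans _ _ (s i `^ (Num.max (2^-1 - al i) 0))); first exact: ler_powR.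
by apply: ge0_ler_powR; rewrite ?nnegrE// le_max lexx orbT.
Qed.
End small_forms.

(** * Forms on counting measures *)

(* The library only makes [counting] a sigma-finite content. *)
HB.instance Definition _ (R : realType) := Measure_isSigmaFinite.Build _ _ _
  (@counting nat R) (sigma_finite_counting R).

Section counting_Lspace.
Context (R : realType).
Local Notation mu := (@counting nat R).

(** The empty set is the only null set of the counting measure. *)
Lemma ae_counting (P : nat -> Prop) : {ae mu, forall x, P x} -> forall x, P x.
Proof.
move=> [N [_ N0 PN]] x; apply: contrapT => Px.
have Nx : N x by exact: PN.
move: N0; rewrite /counting; case: ifPn => // /asboolP finN /eqP.
rewrite eqe pnatr_eq0 finmap.cardfs_eq0 => /eqP/fset_set_set0 => /(_ finN) NE.
by move: Nx; rewrite NE.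
Qed.

Lemma measurable_fun_nat (f : nat -> R) : measurable_fun setT f.
Proof. by []. Qed.

Lemma counting_nat_gt0 : (0 < mu setT)%E.
Proof. by rewrite /counting asboolF ?ltry//; exact: infinite_nat. Qed.

Lemma Lnorm_oo_counting_le (f : nat -> R) (c : R) : 0 <= c ->
  ('N[mu]_+oo[EFin \o f] <= c%:E)%E <-> forall x, `|f x| <= c.
Proof.
move=> c0; rewrite unlock counting_nat_gt0; split=> [/ess_supP fc|fc].
  by apply: ae_counting; apply: filterS fc => x; rewrite /= lee_fin.
by apply/ess_supP; apply: aeW => x; rewrite /= lee_fin.
Qed.

Lemma sum_ord_le_nneseries (N : nat) (f : nat -> R) : (forall k, 0 <= f k) ->
  ((\sum_(k < N) f k)%:E <= \sum_(k <oo) (f k)%:E)%E.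
Proof.
move=> f0; rewrite -sumEFin -(big_mkord xpredT (fun k => (f k)%:E)).
by apply: nneseries_lim_ge => k _; rewrite lee_fin.
Qed.

Lemma nneseries_eq_sum_ord (N : nat) (f : nat -> R) : (forall k, 0 <= f k) ->
  (forall k, (N <= k)%N -> f k = 0) ->
  (\sum_(k <oo) (f k)%:E = (\sum_(k < N) f k)%:E)%E.
Proof.
move=> f0 fN; rewrite (nneseries_split 0 N); last by move=> k _; rewrite lee_fin.
rewrite add0n eseries0 ?adde0; last by move=> k /= Nk _; rewrite fN.
by rewrite big_mkord sumEFin.
Qed.

(** Chebyshev's inequality for finite [q]; for [q = +oo] the exponent is 0 and a single point of [A]
    suffices. *)
Lemma wball_Lnorm (N : nat) (q : \bar R) (f : nat -> R) : (1 <= q)%E ->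
  ('N[mu]_q[EFin \o f] <= 1)%E ->
  wball (fine q^-1) (fun j : 'I_N => f j).
Proof.
case: q => [s|_|//]; last first.
  move=> /(Lnorm_oo_counting_le f ler01) f1 A t /card_gt0P[j jA] t0 At.
  by rewrite invey/= powRr0 mulr1 (le_trans (At _ jA)).
rewrite lee_fin => s1 f1 A t A0 t0 At.
have s0 : 0 < s by rewrite (lt_le_trans ltr01).
rewrite inver gt_eqF//=.
rewrite -lee_fin; apply: le_trans f1; rewrite Lnorm_counting//.
have -> : t * #|A|%:R `^ s^-1 = (\sum_(j in A) t `^ s) `^ s^-1.
  rewrite sumr_const -[in RHS]mulr_natr [in RHS]powRM ?powR_ge0//.
  by rewrite -powRrM mulfV ?gt_eqF// powRr1.
rewrite -poweR_EFin; apply: gt0_ler_poweR.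
- by rewrite invr_ge0 ltW.
- by rewrite in_itv/= leey lee_fin sumr_ge0// => i _; rewrite powR_ge0.
- by rewrite in_itv/= leey nneseries_ge0// => i _ _; rewrite poweR_ge0.
apply: le_trans (sum_ord_le_nneseries N (fun k => powR_ge0 `|f k| s)).
rewrite lee_fin big_mkcond/=; apply: ler_sum => j _.
case: ifPn => jA; last exact: powR_ge0.
by apply: ge0_ler_powR; rewrite ?nnegrE ?(ltW s0)// At.
Qed.

Lemma Lnorm_counting_indic_le (N : nat) (q : \bar R) : (0 < N)%N -> (1 <= q)%E ->
  ('N[mu]_q[EFin \o (fun x => (x < N)%N%:R)] <= (N%:R `^ fine q^-1)%:E)%E.
Proof.
move=> N0; case: q => [s|_|//]; last first.
  rewrite invey/= powRr0; apply/Lnorm_oo_counting_le => // x.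
  by rewrite normr_nat lern1 leq_b1.
rewrite lee_fin => s1; have s0 : 0 < s by rewrite (lt_le_trans ltr01).
rewrite inver gt_eqF//= Lnorm_counting//.
rewrite (@nneseries_eq_sum_ord N (fun k => `|(k < N)%N%:R| `^ s)).
- rewrite (eq_bigr (fun=> 1)); last first.
    by move=> k _; rewrite ltn_ord normr1 powR1.
  by rewrite sumr_const card_ord poweR_EFin.
- by move=> k; exact: powR_ge0.
- by move=> k Nk; rewrite ltnNge Nk normr0 powR0 ?gt_eqF.
Qed.

(** Scalars embed into L^oo as constants, so a multilinear form becomes an operator into L^oo. *)
Lemma Lspace_cst (c : R) : exists u : LspaceType mu (leey 1),
  forall x, (u x : R) = c.
Proof.
have [||u uE] := @Lspace_lift _ _ _ mu _ (leey 1) (cst c).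
- exact: measurable_fun_nat.
- apply: (@le_lt_trans _ _ `|c|%:E); last exact: ltry.
  by apply/Lnorm_oo_counting_le.
- by exists u; exact: ae_counting.
Qed.

Lemma Lspace_delta (q : \bar R) (q1 : (1 <= q)%E) (k : nat) :
  exists u : LspaceType mu q1, forall x, (u x : R) = (x == k)%:R.
Proof.
have [||u uE] := @Lspace_lift _ _ _ mu _ q1 (fun x => (x == k)%:R).
- exact: measurable_fun_nat.
- apply: (@le_lt_trans _ _ (k.+1%:R `^ fine q^-1)%:E); last exact: ltry.
  apply: le_trans (Lnorm_counting_indic_le (ltn0Sn k) q1).
  apply: le_Lnorm_ae => //; apply: aeW => x.
  by rewrite !normr_nat ler_nat; case: eqVneq => // ->; rewrite ltnSn.
- by exists u; exact: ae_counting.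
Qed.

End counting_Lspace.

Lemma mform_delta (R : realType) (m : nat) (J : finType)
    (a : {ffun 'I_m -> J} -> R) (k : {ffun 'I_m -> J}) :
  mform a (fun i j => (j == k i)%:R) = a k.
Proof.
rewrite /mform (bigD1 k)//= [X in _ * X]big1 ?mulr1 => [|i _]; last by rewrite eqxx.
rewrite big1 ?addr0// => l lk.
have [i lki] : exists i, l i != k i.
  by apply/existsP; rewrite -negb_forall; apply: contra lk => /eqfunP/ffunP/eqP.
by rewrite (bigD1 i)//= (negbTE lki) mul0r mulr0.
Qed.

Lemma lee_prod (R : realType) (I : finType) (x y : I -> \bar R) :
  (forall i, (0 <= x i <= y i)%E) -> (\prod_i x i <= \prod_i y i)%E.
Proof.
move=> xy; suff /andP[] : (0 <= \prod_i x i <= \prod_i y i)%E by [].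
elim/big_rec2: _ => [|i u v _ /andP[u0 uv]]; first by rewrite lee01 lexx.
by have /andP[xi0 xyi] := xy i; rewrite mule_ge0// lee_pmul.
Qed.

(** On basis vectors the form takes [N ^ m] values of modulus 1, while the l^s sum of the first [N]
    basis vectors is the indicator of the first [N] integers. *)
Lemma mz_ineq_counting_test (R : realType) (m : nat) (q : 'I_m -> \bar R)
    (q1 : forall i, (1 <= q i)%E) (s C B : R) (N : nat)
    (a : {ffun 'I_m -> 'I_N} -> R) :
  (0 < N)%N -> 0 < s -> 0 <= C -> 0 <= B -> mz_ineq q1 (leey 1) s%:E C ->
  (forall k, `|a k| = 1) ->
  (forall x, (forall i, wball (fine (q i)^-1) (x i)) -> `|mform a x| <= B) ->
  (N ^ m)%:R `^ s^-1 <= C * B * \prod_i N%:R `^ fine (q i)^-1.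
Proof.
move=> N0 s0 C0 B0 mz a1 aB.
pose mu : {sigma_finite_measure set nat -> \bar R} := @counting nat R.
pose F (f : forall i : 'I_m, LspaceType mu (q1 i)) : R :=
  mform a (fun i j => (f i (val j) : R)).
pose T f : LspaceType mu (leey 1) := sval (cid (Lspace_cst (F f))).
have TE f y : (T f y : R) = F f by rewrite /T; case: cid.
have Tlin : multilinear T.
  move=> f i c u v w /ae_counting wE; apply: aeW => y; rewrite !TE.
  have FE (z : LspaceType mu (q1 i)) : F (dfwith f i z) =
      \sum_(j < N) (z (val j) : R) * mform_coef a (fun i j => (f i (val j) : R)) i j.
    rewrite /F (mform_expand _ _ i); apply: eq_bigr => j _.
    rewrite dfwithin; congr (_ * _); apply: eq_mform_coef => i' ii'.
    by rewrite dfwithout// eq_sym.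
  rewrite !FE mulr_sumr -big_split/=; apply: eq_bigr => j _.
  by rewrite wE mulrDl mulrA.
have Top : (opnorm T <= B%:E)%E.
  apply: ge_ereal_sup => _ [f f1 <-].
  apply/Lnorm_oo_counting_le => // y; rewrite TE.
  by apply: aB => i; apply: wball_Lnorm => //; exact: f1.
have Tbd : bounded_multilinear T.
  by split => //; apply: le_lt_trans Top _; rewrite ltry.
pose f i (k : 'I_N) : LspaceType mu (q1 i) :=
  sval (cid (Lspace_delta (q1 i) (val k))).
have fE i k x : (f i k x : R) = (x == val k)%:R by rewrite /f; case: cid.
have := mz _ _ (fun=> mu) _ _ mu T Tbd (fun=> N) f.
set lhs := 'N[_]_(_)[_]%E; set rhs := (X in (_ <= X)%E) => H.
have Hl : (((N ^ m)%:R `^ s^-1)%:E <= lhs)%E.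
  rewrite /lhs unlock counting_nat_gt0; apply: ess_sup_gee.
    exact: counting_nat_gt0.
  apply: aeW => y; rewrite /= lee_fin (ger0_norm (lrnorm_ge0 _ _)).
  rewrite /lrnorm (eq_bigr (fun=> 1)); last first.
    move=> k _; rewrite TE /F.
    have -> : (fun i j => (f i (k i) (val j) : R)) =
        (fun i j => (j == [ffun i => k i] i)%:R).
      by apply/funext => i; apply/funext => j; rewrite fE ffunE.
    by rewrite mform_delta a1 powR1.
  rewrite sumr_const card_dep_ffun foldrE big_image/= prod_nat_const card_ord.
  by rewrite card_ord.
have Hr : (rhs <= (C * B * \prod_i N%:R `^ fine (q i)^-1)%:E)%E.
  apply: (@le_trans _ _ ((C * B)%:E * \prod_i (N%:R `^ fine (q i)^-1)%:E)%E); last first.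
    by rewrite prodEFin EFinM.
  apply: (@le_trans _ _ ((C * B)%:E *
      \prod_(i < m) 'N[mu]_(q i)[(fun x => (lrnorm s%:E (fun k => (f i k x : R)))%:E)])%E).
    apply: lee_wpmul2r; first by apply: prode_ge0 => i _; exact: Lnorm_ge0.
    by rewrite EFinM; apply: lee_wpmul2l; rewrite ?lee_fin.
  apply: lee_wpmul2l; first by rewrite lee_fin mulr_ge0.
  apply: lee_prod => i; rewrite Lnorm_ge0/=.
  apply: le_trans (Lnorm_counting_indic_le N0 (q1 i)).
  apply: le_Lnorm_ae => //; apply: aeW => x.
  rewrite (ger0_norm (lrnorm_ge0 _ _)) normr_nat /lrnorm.
  have [xN|Nx] := ltnP x N.
    rewrite (bigD1 (Ordinal xN))//= fE/= eqxx normr1 powR1 big1 ?addr0 ?powR1//.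
    move=> k kx; have /negbTE xk : x != val k.
      by apply: contra kx => /eqP xk; apply/eqP/val_inj.
    by rewrite fE xk normr0 powR0 ?gt_eqF.
  rewrite big1 ?powR0 ?invr_eq0 ?gt_eqF// => k _.
  by rewrite fE gtn_eqF ?normr0 ?powR0 ?gt_eqF// (leq_trans (ltn_ord k)).
by rewrite -lee_fin; apply: le_trans Hl (le_trans H Hr).
Qed.

(** * The constants *)

Section exponents.
Context (R : realType).
Implicit Types q : \bar R.

Lemma fine_inve_ge0_le1 q : (1 <= q)%E -> 0 <= fine q^-1 <= 1.
Proof.
case: q => [t||//]; last by rewrite invey/= lexx ler01.
rewrite lee_fin => t1; have t0 : 0 < t by exact: lt_le_trans t1.
by rewrite inver gt_eqF//= invr_ge0 (ltW t0) invf_le1.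
Qed.

Lemma le_fine_inve q q' : (1 <= q)%E -> (q <= q')%E -> fine q'^-1 <= fine q^-1.
Proof.
case: q => [t||//]; case: q' => [u||]//=; rewrite ?lee_fin.
- move=> t1 tu; have t0 : 0 < t by exact: lt_le_trans t1.
  have u0 : 0 < u by exact: lt_le_trans tu.
  by rewrite !inver !gt_eqF//= lef_pV2.
- by move=> t1 _; have /andP[] := @fine_inve_ge0_le1 t%:E t1.
Qed.

(** Reciprocals exchange minimum and maximum, and send the infinite exponent to the real number
    0. *)
Lemma inve_min2 q : (1 <= q)%E ->
  ((mine q 2%:E)^-1 = (Num.max 2^-1 (fine q^-1))%:E)%E.
Proof.
case: q => [t||//]; last first.
  by rewrite min_r ?leey// invey inver pnatr_eq0 max_l// invr_ge0.
rewrite lee_fin => t1; have t0 : 0 < t by exact: lt_le_trans t1.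
rewrite -EFin_min !inver (gt_eqF t0)/=; have [t2|t2] := ltP t 2.
  by rewrite gt_eqF// max_r// lef_pV2 ?posrE// ltW.
by rewrite pnatr_eq0/= max_l// lef_pV2 ?posrE.
Qed.

(** Since [1/q' = 1 - 1/q], the value is the smaller of [1/q'] and [1/2]. The endpoints [q = 1] and
    [q = +oo] involve an infinite exponent and are computed apart. *)
Lemma inve_max_conj2 q : (1 <= q)%E ->
  ((maxe (hoelder_conjugate q) 2%:E)^-1 = (1 - Num.max (fine q^-1) 2^-1)%:E)%E.
Proof.
case: q => [t||//]; last first.
  rewrite hoelder_conjugatey invey max_r ?lee_fin ?ler1n// inver pnatr_eq0/=.
  by rewrite max_r ?invr_ge0// => _; congr _%:E; lra.
rewrite lee_fin le_eqVlt => /predU1P[<-|t1].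
  rewrite hoelder_conjugate1 /maxe/= invey inver oner_eq0/= invr1 max_l.
    by rewrite subrr.
  by rewrite invf_le1// ler1n.
have t0 : 0 < t by exact: lt_trans t1.
have tB0 : 0 < t - 1 by rewrite subr_gt0.
rewrite /hoelder_conjugate/= eqe (gt_eqF t0) -EFinB inver (gt_eqF tB0).
rewrite -EFinM -EFin_max !inver (gt_eqF t0)/=.
have E : 1 - t^-1 = (t / (t - 1))^-1 by field; rewrite !gt_eqF.
have [t2|t2] := leP (t / (t - 1)) 2.
  rewrite pnatr_eq0/= max_r; first by congr EFin; lra.
  by rewrite lef_pV2 ?posrE//; move: t2; rewrite ler_pdivrMr//; lra.
rewrite gt_eqF ?divr_gt0// max_l ?E//.
by rewrite lef_pV2 ?posrE//; move: t2; rewrite ltr_pdivlMr//; lra.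
Qed.

Lemma exp_beats_poly (m : nat) (de K : R) : 0 < de -> 0 <= K ->
  exists n : nat, K * (2 * n%:R + 1) ^+ m < (2 ^+ n) `^ de.
Proof.
move=> de0 K0; pose c := de * ln 2.
have c0 : 0 < c by rewrite mulr_gt0// ln_gt0// ltr1n.
(* [n > Z] means that [K * (3 * n) ^+ m] is below the term of degree [m.+1] in the Taylor series of
   [expR (c * n)]; moreover [2 * n + 1 <= 3 * n]. *)
pose Z := K * 3 ^+ m * m.+1`!%:R / c ^+ m.+1.
have Z0 : 0 <= Z.
  by apply: divr_ge0; [rewrite !mulr_ge0 ?exprn_ge0|rewrite exprn_ge0 ?(ltW c0)].
exists (Num.bound Z).+1; set n := (Num.bound Z).+1.
have Zn : Z < n%:R.
  apply: lt_trans (_ : (Num.bound Z)%:R < n%:R); last by rewrite ltr_nat.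
  by rewrite archi_boundP.
have n1 : 1 <= n%:R :> R by rewrite ler1n.
have n0 : 0 < n%:R :> R by rewrite ltr0n.
have -> : (2 ^+ n) `^ de = expR (c * n%:R) :> R.
  rewrite /powR gt_eqF ?exprn_gt0// lnXn// /c; congr expR.
  by rewrite -[ln 2 *+ n]mulr_natr mulrA.
apply: lt_le_trans (expR_ge1Dxn m _); last by rewrite mulr_ge0// ltW.
apply: (@le_lt_trans _ _ (K * (3 * n%:R) ^+ m)).
  by apply: ler_wpM2l => //; apply: lerXn2r; rewrite ?nnegrE; lra.
apply: (@lt_trans _ _ ((c * n%:R) ^+ m.+1 / m.+1`!%:R)); last by rewrite ltrDr.
have f0 : 0 < m.+1`!%:R :> R by rewrite ltr0n fact_gt0.
rewrite ltr_pdivlMr// !exprMn (exprS n%:R) mulrA.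
rewrite (_ : K * (3 ^+ m * n%:R ^+ m) * _ = K * 3 ^+ m * m.+1`!%:R * n%:R ^+ m); last by ring.
rewrite ltr_pM2r ?exprn_gt0//.
by move: Zn; rewrite /Z ltr_pdivrMr ?exprn_gt0// [ltRHS]mulrC /c exprMn.

Qed.

End exponents.

Lemma mz_const_linear_Loo (R : realType) (q : 'I_1 -> \bar R)
    (q1 : forall i, (1 <= q i)%E) (s : R) :
  1 <= s -> (mz_const q1 (leey 1) s%:E = 1)%E.
Proof.
move=> s1; apply/eqP; rewrite eq_le; apply/andP; split.
  apply: ereal_inf_lbound; exists 1 => //=; split => //.
  exact: mz_ineq_linear_Loo.
by apply: le_ereal_inf_tmp => _ [C [C1 _] <-]; rewrite lee_fin.
Qed.

Lemma mz_const_multilinear_Loo (R : realType) (m : nat) (q : 'I_m -> \bar R)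
    (q1 : forall i, (1 <= q i)%E) (be s : R) :
  (0 < m)%N -> 0 < s -> 0 <= be <= 2^-1 ->
  (forall i, 1 - be - fine (q i)^-1 <= Num.max (2^-1 - fine (q i)^-1) 0) ->
  be + \sum_i Num.max 2^-1 (fine (q i)^-1) < m%:R / s ->
  mz_const q1 (leey 1) s%:E = +oo%E.
Proof.
move=> m0 s0 be01 albe lt_ms; rewrite /mz_const.
rewrite (_ : [set C | _] = set0) ?image_set0 ?ereal_inf0//.
apply/seteqP; split => // C [C1 mz].
have C0 : 0 <= C by exact: le_trans C1.
pose al i := fine (q i)^-1.
pose E := be + \sum_i Num.max (2^-1 - al i) 0.
(* The gap between the two exponents of [2 ^+ n]; it is positive because [max(1/2 - al i, 0) + al i
   = max(1/2, al i)]. *)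
pose de := m%:R / s - (E + \sum_i al i).
have de0 : 0 < de.
  rewrite subr_gt0; apply: le_lt_trans lt_ms; rewrite -addrA -big_split/=.
  rewrite lerD2l; apply: ler_sum => i _.
  by rewrite /al maxEle; case: ifPn => _; rewrite le_max ?add0r ?subrK ?lexx ?orbT.
have K0 : 0 <= C * (24 * m%:R) by rewrite !mulr_ge0.
have [n Hn] := exp_beats_poly m de0 K0.
have N0 : (0 < 2 ^ n)%N by rewrite expn_gt0.
have [a [a1 aB]] := exists_mform n m0 (fun i => fine_inve_ge0_le1 (q1 i)) be01 albe.
have := mz_ineq_counting_test N0 s0 C0 _ mz a1 aB.
have NE : (2 ^ n)%:R = 2 ^+ n :> R by rewrite natrX.
have p0 : 0 < 2 ^+ n :> R by rewrite exprn_gt0.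
rewrite natrX NE !mulr_ge0 ?powR_ge0 ?exprn_ge0 ?addr_ge0 ?mulr_ge0// => /(_ isT).
have -> : \prod_(i < m) (2 ^+ n) `^ fine (q i)^-1 =
    (2 ^+ n) `^ (\sum_i al i) :> R.
  apply/esym; apply: (big_morph (fun t => (2 ^+ n) `^ t)) => [u v|].
    by rewrite powRD// (gt_eqF p0) implybT.
  by rewrite powRr0.
rewrite -/E -(powR_mulrn _ (ltW p0)) -powRrM.
have -> : m%:R / s = de + (E + \sum_i al i) by rewrite /de subrK.
rewrite 2?powRD ?(gt_eqF p0) ?implybT//.
apply/negP; rewrite -ltNge.
rewrite (_ : C * _ * _ = (C * (24 * m%:R) * (2 * n%:R + 1) ^+ m) *
  ((2 ^+ n) `^ E * (2 ^+ n) `^ (\sum_i al i))); last by ring.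
by rewrite ltr_pM2r ?mulr_gt0 ?powR_gt0.
Qed.

Local Close Scope classical_set_scope.
Local Open Scope ereal_scope.

Theorem proposition1p7 (R : realType) (m : nat) (m_gt0 : (0 < m)%N)
    (q : 'I_m -> \bar R) (q1 : forall i, 1 <= q i) (r : \bar R) :
  let Q := \big[maxe/-oo]_(i < m) q i in
  let Q' := hoelder_conjugate Q in
  1 <= r ->
  r < (m%:R)%:E * ((maxe Q' 2%:E)^-1 + \sum_(i < m) (mine (q i) 2%:E)^-1)^-1 ->
  mz_const q1 (leey 1) r = +oo /\
  forall i : 'I_m, mz_const (fun _ : 'I_1 => q1 i) (leey 1) r = 1.
Proof.
move=> Q Q'.
have qQ i : q i <= Q by exact: le_bigmax.
have Q1 : 1 <= Q by apply: le_trans (q1 (Ordinal m_gt0)) (qQ _).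
rewrite inve_max_conj2// (eq_bigr _ (fun i _ => inve_min2 (q1 i))) sumEFin -EFinD.
set be := (1 - _)%R; set D := (be + _)%R.
have be01 : (0 <= be <= 2^-1)%R.
  have /andP[Q0 Q01] := fine_inve_ge0_le1 Q1.
  rewrite subr_ge0 ge_max Q01 invf_le1// ler1n/=.
  have : (2^-1 <= Num.max (fine Q^-1) 2^-1)%R by rewrite le_max lexx orbT.
  by rewrite /be; lra.
have D0 : (0 < D)%R.
  have /andP[be0 _] := be01; rewrite ltr_wpDl// (bigD1 (Ordinal m_gt0))//=.
  rewrite ltr_wpDr ?lt_max ?invr_gt0 ?ltr0n//.
  by apply: sumr_ge0 => i _; rewrite le_max invr_ge0 ler0n.
rewrite inver gt_eqF// -EFinM.
(* The upper bound on [r] is now a real number, which excludes [r = +oo]. *)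
case: r => [s||]//; rewrite lee_fin lte_fin => s1 sD.
have s0 : (0 < s)%R by exact: lt_le_trans s1.
split; last by move=> i; exact: mz_const_linear_Loo.
apply: (@mz_const_multilinear_Loo _ _ _ q1 be) => //.
- move=> i; have := le_fine_inve (q1 i) (qQ i).
  (* If [1/Q <= 1/2], then [be = 1/2] and the bound is immediate; otherwise
     [1 - be - 1/q_i = 1/Q - 1/q_i <= 0], because [q i <= Q]. *)
  rewrite /be !maxEle; do 2 case: ifPn; rewrite -?ltNge => *; lra.
- by rewrite ltr_pdivlMr// mulrC -ltr_pdivlMr.
Qed.
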